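(* Let $C$ be a circle packing in the plane with the combinatorics of a triangulated disk $G=(V,E,F)$, let $MG$ be its medial graph, and let $z:V(MG)\to\mathbb{C}$ denote the tangency points. Then a function $\Phi:F(G)\to sl(2,\mathbb{C})$ represents an infinitesimal deformation of the circle packing if and only if there exists $\lambda:E_{int}(G)\to\mathbb{R}$ (with $\lambda_{\mathfrak{uv}}=\lambda_{\mathfrak{vu}}$) such that for every interior edge $\{\mathfrak{uv}\}\in E_{int}(G)$, with left face $\{\mathfrak{uvs}\}$ and right face $\{\mathfrak{vut}\}$ of $e_{\mathfrak{uv}}$ and tangency point $z_i$ of $C_{\mathfrak{u}}$ and $C_{\mathfrak{v}}$, $$\Phi_{\mathfrak{uvs}}-\Phi_{\mathfrak{vut}}=\frac{\lambda_{\mathfrak{uv}}}{\omega(e_{\mathfrak{uv}})}\begin{pmatrix} z_i & -z_i^2\\ 1 & -z_i\end{pmatrix}.$$ In this case, $\lambda$ is a holomorphic quadratic differential of Koebe type and $\lambda=\dot{\mathrm{cr}}^{\dagger}/\mathrm{cr}^{\dagger}$, where $\dot{\mathrm{cr}}^\dagger$ is the first-order change of the cross ratios $\mathrm{cr}^\dagger$ under the infinitesimal deformation. The deformation is induced by a global (infinitesimal) Möbius transformation if and only if $\lambda\equiv 0$.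
   Context: Circle packing: $G=(V,E,F)$ is an oriented triangulated disk with boundary. Each vertex $\mathfrak{u}$ carries a circle $C_{\mathfrak{u}}\subset\mathbb{C}$ with center $c_{\mathfrak{u}}$ and radius $R_{\mathfrak{u}}>0$; the disks they bound have disjoint interiors, $C_{\mathfrak u}$ and $C_{\mathfrak v}$ are tangent for every edge $\{\mathfrak{uv}\}$ (so $|c_{\mathfrak v}-c_{\mathfrak u}|=R_{\mathfrak u}+R_{\mathfrak v}$), and the triangles of centers realize the faces of $G$ with counterclockwise orientation. $E_{int}(G)$ and $V_{int}(G)$ are the interior edges and interior vertices. The medial graph $MG$ has one vertex for each edge of $G$, so $V(MG)=E(G)$, and $z$ assigns to each edge the tangency point of its two circles. Local notation: for an interior edge $\{\mathfrak{uv}\}$, $e_{\mathfrak{uv}}$ is the edge oriented from $\mathfrak u$ to $\mathfrak v$, $\{\mathfrak{uvs}\}$ is the face on its left and $\{\mathfrak{vut}\}$ the face on its right. The tangency points are $z_i\in C_{\mathfrak u}\cap C_{\mathfrak v}$, $z_j\in C_{\mathfrak v}\cap C_{\mathfrak s}$, $z_k\in C_{\mathfrak s}\cap C_{\mathfrak u}$, $z_m\in C_{\mathfrak t}\cap C_{\mathfrak u}$, $z_n\in C_{\mathfrak t}\cap C_{\mathfrak v}$. Define $\omega(e_{\mathfrak{uv}}):=\frac{(z_k-z_i)(z_m-z_i)}{z_m-z_k}$ (one has $\omega(e_{\mathfrak{vu}})=-\omega(e_{\mathfrak{uv}})$). Cross ratio: $\mathrm{cr}(z_1,z_2,z_3,z_4)=\frac{(z_1-z_2)(z_3-z_4)}{(z_2-z_3)(z_4-z_1)}$,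 and $\mathrm{cr}^\dagger_{\mathfrak{uv}}:=\mathrm{cr}(z_i,z_j,z_k,z_m)=\mathrm{cr}(z_i,z_m,z_n,z_j)$, a purely imaginary number attached to the interior edge $\{\mathfrak{uv}\}$. Holomorphic quadratic differential of Koebe type: a function $\lambda:E_{int}(G)\to\mathbb{R}$ such that for every interior vertex $\mathfrak u\in V_{int}(G)$, summing over all neighbors $\mathfrak v$ of $\mathfrak u$ (with $z_i$ the tangency point of $C_{\mathfrak u}$ and $C_{\mathfrak v}$), $\sum_{\mathfrak v}\frac{\lambda_{\mathfrak{uv}}}{\omega(e_{\mathfrak{uv}})}=0$, $\sum_{\mathfrak v}\frac{\lambda_{\mathfrak{uv}}}{\omega(e_{\mathfrak{uv}})}z_i=0$, $\sum_{\mathfrak v}\frac{\lambda_{\mathfrak{uv}}}{\omega(e_{\mathfrak{uv}})}z_i^2=0$. Infinitesimal deformation of the circle packing: first-order changes $\dot c:V\to\mathbb{C}$ of centers and $\dot R:V\to\mathbb{R}$ of radii preserving tangency to first order, i.e. $\langle\dot c_{\mathfrak v}-\dot c_{\mathfrak u},c_{\mathfrak v}-c_{\mathfrak u}\rangle=(\dot R_{\mathfrak u}+\dot R_{\mathfrak v})(R_{\mathfrak u}+R_{\mathfrak v})$ for every edge (real inner product on $\mathbb{C}=\mathbb{R}^2$). It induces a first-order change $\dot z:V(MG)\to\mathbb{C}$ of tangency points by differentiating $z_i=c_{\mathfrak u}+\frac{R_{\mathfrak u}}{R_{\mathfrak u}+R_{\mathfrak v}}(c_{\mathfrak v}-c_{\mathfrak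 u})$. For any three distinct points $z_1,z_2,z_3\in\mathbb{C}$ and any $\dot z_1,\dot z_2,\dot z_3\in\mathbb{C}$ there is a unique $\Psi\in sl(2,\mathbb{C})$ (trace-zero $2\times2$ complex matrix) with $\dot z_a=\det\left(\Psi\binom{z_a}{1},\binom{z_a}{1}\right)$ for $a=1,2,3$. The function $\Phi$ ''represents'' the infinitesimal deformation if for every face $\{\mathfrak{uvs}\}$ the matrix $\Phi_{\mathfrak{uvs}}$ is the one so determined by the three tangency points of $C_{\mathfrak u},C_{\mathfrak v},C_{\mathfrak s}$ and their changes $\dot z$. The deformation is induced by a global Möbius transformation if there is a single $\Psi\in sl(2,\mathbb{C})$ with $\dot z_a=\det\left(\Psi\binom{z_a}{1},\binom{z_a}{1}\right)$ for all $a\in V(MG)$. *)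

(* Defs.v *)
(* Infinitesimal deformations of circle packings of triangulated disks, in
   MathComp / MathComp-Analysis; the complex numbers are R[i], R : realType. *)
From mathcomp Require Export all_boot all_order all_algebra.
From mathcomp Require Export complex.
From mathcomp Require Export reals normedtype derive.

Set Implicit Arguments.
Unset Strict Implicit.
Unset Printing Implicit Defensive.

Import Order.TTheory GRing.Theory Num.Theory.
Import numFieldNormedType.Exports.

Local Open Scope ring_scope.
Local Open Scope complex_scope.

(** * Oriented triangulated disks *)

Section Complex.

Variables (V : finType) (face : V -> V -> V -> bool).

Definition edge_of (u v : V) : bool := [exists s, face u v s || face v u s].

Definition edge_sets : {set {set V}} :=
  [set [set e.1; e.2] | e : V * V & edge_of e.1 e.2].

Definition face_sets : {set {set V}} :=
  [set [set f.1.1; f.1.2; f.2] | f : V * V * V & face f.1.1 f.1.2 f.2].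

End Complex.

(* [face u v s] means that {u, v, s} is a face and that (u, v, s) is its
   positive cyclic order, i.e. that the face lies to the left of the edge
   oriented from u to v.  [face_fun] says both that an edge is in at most two
   faces and that adjacent faces are coherently oriented.  With connected
   vertex links (hence paths or cycles) the complex is then a connected compact
   oriented surface, which is a disk iff its Euler characteristic is 1 (closed
   oriented surfaces have even Euler characteristic, so the boundary is
   nonempty). *)
Record triangulated_disk (V : finType) := TriangulatedDisk {
  face :> V -> V -> V -> bool;
  face_rot : forall u v s, face u v s -> face v s u;
  face_neq : forall u v s, face u v s -> u != v;
  face_asym : forall u v s, face u v s -> ~~ face v u s;
  face_fun : forall u v s t, face u v s -> face u v t -> s = t;
  face_cover : forall u, exists v s, face u v s;
  link_connected : forall u v w, edge_of face u v -> edge_of face u w ->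
    connect (fun s t => face u s t || face u t s) v w;
  disk_connected : forall u v, connect (edge_of face) u v;
  euler_char1 : (#|V| + #|face_sets face| = #|edge_sets face| + 1)%N
}.

Section Disk.

Variables (V : finType) (G : triangulated_disk V).

Definition edge (u v : V) : bool := edge_of G u v.

Definition interior_edge (u v : V) : bool :=
  [exists s, G u v s] && [exists t, G v u t].

Definition interior_vertex (u : V) : bool :=
  [forall v, edge u v ==> interior_edge u v].

(* The third vertex s of the face {uvs} to the left of e_uv; the third vertex t
   of the face {vut} to its right is [apex v u].  The value is the junk value u
   if there is no face to the left of e_uv. *)
Definition apex (u v : V) : V := odflt u [pick s | G u v s].

Definition left_face (u v : V) : {set V} := [set u; v; apex u v].

Definition right_face (u v : V) : {set V} := left_face v u.

End Disk.

(** * Circle packings *)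

Section Packing.

Variables (R : realType) (V : finType).

Record circles := Circles { center : V -> R[i]; radius : V -> R }.

Definition tangency_point (P : circles) (u v : V) : R[i] :=
  center P u +
  (radius P u / (radius P u + radius P v))%:C * (center P v - center P u).

Definition dotC (a b : R[i]) : R := complex.Re a * complex.Re b + complex.Im a * complex.Im b.

Definition ccw (a b c : R[i]) : Prop :=
  0 < complex.Re (b - a) * complex.Im (c - a)
    - complex.Im (b - a) * complex.Re (c - a).

Definition open_disk (P : circles) (u : V) (x : R[i]) : Prop :=
  `|x - center P u| < (radius P u)%:C.

Record circle_packing (G : triangulated_disk V) (P : circles) : Prop :=
  CirclePacking {
    radius_gt0 : forall u, 0 < radius P u;
    disjoint_disks : forall u v x,
      u != v -> ~ (open_disk P u x /\ open_disk P v x);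
    tangent_circles : forall u v, edge G u v ->
      `|center P v - center P u| = (radius P u + radius P v)%:C;
    ccw_faces : forall u v s, G u v s ->
      ccw (center P u) (center P v) (center P s)
  }.

Definition cross_ratio (z1 z2 z3 z4 : R[i]) : R[i] :=
  ((z1 - z2) * (z3 - z4)) / ((z2 - z3) * (z4 - z1)).

Section Quantities.

Variables (G : triangulated_disk V) (P : circles) (u v : V).

Let s := apex G u v.
Let t := apex G v u.
Let zi := tangency_point P u v.
Let zj := tangency_point P v s.
Let zk := tangency_point P s u.
Let zm := tangency_point P t u.

Definition omega : R[i] := ((zk - zi) * (zm - zi)) / (zm - zk).

(* At the reversed edge e_vu this is the other expression
   cr(z_i, z_m, z_n, z_j) of the same number. *)
Definition cr_dagger : R[i] := cross_ratio zi zj zk zm.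

End Quantities.

(* A real function on the edges is a function on the sets {u, v}, so that it is
   symmetric in u and v; only its values on interior edges are ever used. *)
Definition koebe_quadratic_differential (G : triangulated_disk V) (P : circles)
    (lambda : {set V} -> R) : Prop :=
  forall u, interior_vertex G u ->
    [/\ \sum_(v | edge G u v) (lambda [set u; v])%:C / omega G P u v = 0,
        \sum_(v | edge G u v) (lambda [set u; v])%:C / omega G P u v
          * tangency_point P u v = 0
      & \sum_(v | edge G u v) (lambda [set u; v])%:C / omega G P u v
          * tangency_point P u v ^+ 2 = 0].

(** * Infinitesimal deformations *)

Record variation := Variation { dcenter : V -> R[i]; dradius : V -> R }.

Definition infinitesimal_deformation (G : triangulated_disk V) (P : circles)
    (D : variation) : Prop :=
  forall u v, edge G u v ->
    dotC (dcenter D v - dcenter D u) (center P v - center P u)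
    = (dradius D u + dradius D v) * (radius P u + radius P v).

Definition deform (P : circles) (D : variation) (e : R) : circles :=
  Circles (fun u => center P u + e%:C * dcenter D u)
          (fun u => radius P u + e * dradius D u).

(* The derivative at 0 of a complex function of a real variable. *)
Definition deriv0 (f : R -> R[i]) : R[i] :=
  derive1 (fun e => complex.Re (f e)) 0
  +i* derive1 (fun e => complex.Im (f e)) 0.

Definition first_order_change (f : circles -> R[i]) (P : circles)
    (D : variation) : R[i] :=
  deriv0 (fun e => f (deform P D e)).

Definition dtangency_point (P : circles) (D : variation) (u v : V) : R[i] :=
  first_order_change (fun Q => tangency_point Q u v) P D.

Definition dcr_dagger (G : triangulated_disk V) (P : circles) (D : variation)
    (u v : V) : R[i] :=
  first_order_change (fun Q => cr_dagger G Q u v) P D.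

(** * Infinitesimal Moebius transformations *)

Definition sl2 := {A : 'M[R[i]]_2 | \tr A == 0}.

Definition homogeneous (z : R[i]) : 'cV[R[i]]_2 :=
  \col_i (if i == 0 then z else 1).

Definition moebius_field (Psi : sl2) (z : R[i]) : R[i] :=
  \det (row_mx (val Psi *m homogeneous z) (homogeneous z) : 'M[R[i]]_2).

Definition mx2 (a b c d : R[i]) : 'M[R[i]]_2 :=
  \matrix_(i, j) if i == 0 then (if j == 0 then a else b)
                 else (if j == 0 then c else d).

(* Functions on the faces are functions on the sets {u, v, s}; only their values
   on the faces of G are ever used. *)
Definition represents (G : triangulated_disk V) (P : circles)
    (Phi : {set V} -> sl2) (D : variation) : Prop :=
  forall u v s, G u v s ->
    let Psi := Phi [set u; v; s] in
    [/\ dtangency_point P D u v = moebius_field Psi (tangency_point P u v),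
        dtangency_point P D v s = moebius_field Psi (tangency_point P v s)
      & dtangency_point P D s u = moebius_field Psi (tangency_point P s u)].

Definition jump_condition (G : triangulated_disk V) (P : circles)
    (Phi : {set V} -> sl2) (lambda : {set V} -> R) : Prop :=
  forall u v, interior_edge G u v ->
    let zi := tangency_point P u v in
    val (Phi (left_face G u v)) - val (Phi (right_face G u v))
    = ((lambda [set u; v])%:C / omega G P u v) *: mx2 zi (- zi ^+ 2) 1 (- zi).

Definition induced_by_global_moebius (G : triangulated_disk V) (P : circles)
    (D : variation) : Prop :=
  exists Psi : sl2, forall u v, edge G u v ->
    dtangency_point P D u v = moebius_field Psi (tangency_point P u v).

End Packing.

(* Main.v *)
(* A trace-zero matrix moves every circle, to first order, to a circle, and this
   preserves tangency.  In a face, the changes of the three tangency points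
   determine those of the three circles: if they vanish, the circles can only
   rotate about the tangency points, with angular speeds that sum to zero in
   pairs.  So representing a deformation means that the matrices of the two faces
   at an interior edge {uv} move C_u and C_v in the same way, i.e. that their
   difference is infinitesimally parabolic at z_i and preserves C_u and C_v; the
   real multiples of [1 / omega] are exactly the coefficients with this property.
   Conversely, since vertex links are connected, the changes of C_u prescribed by
   the faces around u then agree.  The Koebe conditions hold as the jumps around
   an interior vertex telescope, and the formula for lambda is Moebius invariance
   of the cross ratio, as only z_m is moved by the matrix of the right face. *)
Require Import Defs.
From mathcomp Require Import boolp functions realfun ring lra.

Set Implicit Arguments.
Unset Strict Implicit.
Unset Printing Implicit Defensive.

Import Order.TTheory GRing.Theory Num.Theory.
Import numFieldNormedType.Exports.

Local Open Scope ring_scope.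
Local Open Scope complex_scope.

(* Without this, [x ^*] can be read in ring_scope as [Num.conj], to which the
   lemmas on [conjc] do not apply syntactically. *)
Local Notation "x ^*" := (conjc x) : ring_scope.

(** * Derivatives of complex functions of a real variable *)

Section Deriv0.
Variable R : realType.
Implicit Types (f g : R -> R[i]) (a b : R[i]).

(** [deriv0] has a value for every function; the relational form carries differentiability along
    with the value, so that the usual rules compose. *)
Definition has_deriv0 f a :=
  is_derive (0 : R) (1 : R) (fun e => complex.Re (f e)) (complex.Re a) /\
  is_derive (0 : R) (1 : R) (fun e => complex.Im (f e)) (complex.Im a).

Lemma has_deriv0E f a : has_deriv0 f a -> deriv0 f = a.
Proof.
by case=> fr fi; rewrite /deriv0 !derive1E !derive_val; case: a {fr fi}.
Qed.

Lemma has_deriv0_ext f g a : f =1 g -> has_deriv0 f a -> has_deriv0 g a.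
Proof. by move=> /funext ->. Qed.

Lemma has_deriv0_cst b : has_deriv0 (fun=> b) 0.
Proof. by split; apply: is_derive_cst. Qed.

Lemma has_deriv0_real : has_deriv0 (fun e => e%:C) 1.
Proof. by split; [apply: is_derive_id|apply: is_derive_cst]. Qed.

Lemma has_deriv0D f g a b : has_deriv0 f a -> has_deriv0 g b ->
  has_deriv0 (fun e => f e + g e) (a + b).
Proof.
move=> [fr fi] [gr gi]; split.
- have -> : (fun e => complex.Re (f e + g e)) =
    (fun e => complex.Re (f e)) + (fun e => complex.Re (g e)).
    by apply/funext => e; rewrite raddfD.
  by rewrite raddfD; apply: is_deriveD.
- have -> : (fun e => complex.Im (f e + g e)) =
    (fun e => complex.Im (f e)) + (fun e => complex.Im (g e)).
    by apply/funext => e; rewrite raddfD.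
  by rewrite raddfD; apply: is_deriveD.
Qed.

Lemma has_deriv0N f a : has_deriv0 f a -> has_deriv0 (fun e => - f e) (- a).
Proof.
move=> [fr fi]; split.
- have -> : (fun e => complex.Re (- f e)) = - (fun e => complex.Re (f e)).
    by apply/funext => e; rewrite raddfN.
  by rewrite raddfN; apply: is_deriveN.
- have -> : (fun e => complex.Im (- f e)) = - (fun e => complex.Im (f e)).
    by apply/funext => e; rewrite raddfN.
  by rewrite raddfN; apply: is_deriveN.
Qed.

Lemma has_deriv0M f g a b : has_deriv0 f a -> has_deriv0 g b ->
  has_deriv0 (fun e => f e * g e) (a * g 0 + f 0 * b).
Proof.
move=> [fr fi] [gr gi]; split.
- have -> : (fun e => complex.Re (f e * g e)) =
    (fun e => complex.Re (f e)) * (fun e => complex.Re (g e)) -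
    (fun e => complex.Im (f e)) * (fun e => complex.Im (g e)).
    by apply/funext => e; rewrite !fctE; case: (f e) => ? ?; case: (g e).
  apply: (is_derive_eq (is_deriveB (is_deriveM fr gr) (is_deriveM fi gi)));
    case: (f 0) (g 0) a b {fr fi gr gi} => [? ?] [? ?] [? ?] [? ?] /=.
  by rewrite /GRing.scale /=; ring.
- have -> : (fun e => complex.Im (f e * g e)) =
    (fun e => complex.Re (f e)) * (fun e => complex.Im (g e)) +
    (fun e => complex.Im (f e)) * (fun e => complex.Re (g e)).
    by apply/funext => e; rewrite !fctE; case: (f e) => ? ?; case: (g e).
  apply: (is_derive_eq (is_deriveD (is_deriveM fr gi) (is_deriveM fi gr)));
    case: (f 0) (g 0) a b {fr fi gr gi} => [? ?] [? ?] [? ?] [? ?] /=.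
  by rewrite /GRing.scale /=; ring.
Qed.

Lemma normC2_neq0 (z : R[i]) : z != 0 ->
  complex.Re z ^+ 2 + complex.Im z ^+ 2 != 0.
Proof.
case: z => x y; rewrite eq_complex /= negb_and paddr_eq0 ?sqr_ge0 //.
by rewrite !sqrf_eq0 negb_and.
Qed.

Lemma has_deriv0V f a : f 0 != 0 -> has_deriv0 f a ->
  has_deriv0 (fun e => (f e)^-1) (- a / f 0 ^+ 2).
Proof.
move=> /normC2_neq0 f0 [fr fi].
(* [n] is the squared modulus of [f]: the inverse of [f] has components [Re f / n] and
   [- Im f / n]. *)
pose n := (fun e => complex.Re (f e)) ^+ 2 + (fun e => complex.Im (f e)) ^+ 2 : R -> R.
have n0 : n 0 != 0 by [].
have Dn := is_deriveV n0 (is_deriveD (is_deriveX 2 fr) (is_deriveX 2 fi)).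
split.
- have -> : (fun e => complex.Re (f e)^-1) =
    (fun e => complex.Re (f e)) * (fun e => (n e)^-1).
    by apply/funext => e; rewrite /n !fctE; case: (f e).
  apply: (is_derive_eq (is_deriveM fr Dn)); rewrite /n !fctE /GRing.scale /=.
  case: (f 0) a f0 {fr fi n n0 Dn} => [x y] [x' y'] /= f0.
  rewrite expr2 /=.
  (* Multiplicativity of the squared modulus, applied to the square of [f 0], leaves [f0] as the
     only side condition of [field]. *)
  have -> : (x * x - y * y) ^+ 2 + (x * y + y * x) ^+ 2 =
    (x ^+ 2 + y ^+ 2) ^+ 2 by ring.
  by field.
- have -> : (fun e => complex.Im (f e)^-1) =
    (- (fun e => complex.Im (f e))) * (fun e => (n e)^-1).
    by apply/funext => e; rewrite /n !fctE; case: (f e) => ? ? /=; rewrite mulNr.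
  apply: (is_derive_eq (is_deriveM (is_deriveN fi) Dn)); rewrite /n !fctE /GRing.scale /=.
  case: (f 0) a f0 {fr fi n n0 Dn} => [x y] [x' y'] /= f0.
  rewrite expr2 /=.
  have -> : (x * x - y * y) ^+ 2 + (x * y + y * x) ^+ 2 =
    (x ^+ 2 + y ^+ 2) ^+ 2 by ring.
  by field.
Qed.

End Deriv0.

(** * First-order changes of tangency points and cross ratios *)

Section Changes.
Variables (R : realType) (V : finType).
Implicit Types (P : circles R V) (D : variation R V).

Lemma deform0 P D : deform P D 0 = P.
Proof.
by case: P => c r; congr Circles; apply/funext => u /=; rewrite mul0r addr0.
Qed.

Lemma has_deriv0_affine (a b : R[i]) : has_deriv0 (fun e => a + e%:C * b) b.
Proof.
have := has_deriv0D (has_deriv0_cst a)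
  (has_deriv0M (has_deriv0_real R) (has_deriv0_cst b)).
by rewrite mulr0 addr0 mul1r add0r.
Qed.

(** The product rule applied to [tangency_point]; the real coefficient in the middle is the
    derivative of [R_u / (R_u + R_v)]. *)
Definition tangency_change P D u v : R[i] :=
  let S := radius P u + radius P v in
  dcenter D u
  + ((dradius D u * radius P v - radius P u * dradius D v) / S ^+ 2)%:C
    * (center P v - center P u)
  + (radius P u / S)%:C * (dcenter D v - dcenter D u).

Lemma has_deriv0_tangency P D u v : radius P u + radius P v != 0 ->
  has_deriv0 (fun e => tangency_point (deform P D e) u v)
    (tangency_change P D u v).
Proof.
move=> S0; have S0' : (radius P u)%:C + (radius P v)%:C != 0.
  by rewrite -rmorphD fmorph_eq0.
have HR w := has_deriv0_affine (radius P w)%:C (dradius D w)%:C.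
have Hc w := has_deriv0_affine (center P w) (dcenter D w).
have S1 : (radius P u)%:C + 0%:C * (dradius D u)%:C +
  ((radius P v)%:C + 0%:C * (dradius D v)%:C) != 0 by rewrite !mul0r !addr0.
have H := has_deriv0D (Hc u) (has_deriv0M (has_deriv0M (HR u)
  (has_deriv0V S1 (has_deriv0D (HR u) (HR v))))
  (has_deriv0D (Hc v) (has_deriv0N (Hc u)))).
apply: (@has_deriv0_ext _ _ _ (tangency_change P D u v)); last first.
  apply: (eq_rect _ _ H).
  rewrite /tangency_change !mul0r !addr0.
  rewrite !(rmorphM, rmorphB, rmorphD, fmorphV, rmorphXn) /=.
  by field.
by move=> e; rewrite /tangency_point /= !(rmorphM, rmorphB, rmorphD, fmorphV) /=.
Qed.

Lemma dtangency_pointE P D u v : radius P u + radius P v != 0 ->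
  dtangency_point P D u v = tangency_change P D u v.
Proof. by move=> S0; apply: has_deriv0E; apply: has_deriv0_tangency. Qed.

(** The second factor is the logarithmic derivative, the form needed for the quotient of the change
    of [cr_dagger] by [cr_dagger]. *)
Lemma has_deriv0_cross_ratio (f1 f2 f3 f4 : R -> R[i]) (d1 d2 d3 d4 : R[i]) :
  has_deriv0 f1 d1 -> has_deriv0 f2 d2 -> has_deriv0 f3 d3 ->
  has_deriv0 f4 d4 -> f1 0 != f2 0 -> f2 0 != f3 0 -> f3 0 != f4 0 ->
  f4 0 != f1 0 ->
  has_deriv0 (fun e => cross_ratio (f1 e) (f2 e) (f3 e) (f4 e))
    (cross_ratio (f1 0) (f2 0) (f3 0) (f4 0) *
     ((d1 - d2) / (f1 0 - f2 0) - (d2 - d3) / (f2 0 - f3 0)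
      + (d3 - d4) / (f3 0 - f4 0) - (d4 - d1) / (f4 0 - f1 0))).
Proof.
move=> h1 h2 h3 h4; rewrite -(subr_eq0 (f1 0)) => n12.
rewrite -(subr_eq0 (f2 0)) => n23; rewrite -(subr_eq0 (f3 0)) => n34.
rewrite -(subr_eq0 (f4 0)) => n41.
have HB (f g : R -> R[i]) a b (hf : has_deriv0 f a) (hg : has_deriv0 g b) :=
  has_deriv0D hf (has_deriv0N hg).
have n : (f2 0 - f3 0) * (f4 0 - f1 0) != 0 by rewrite mulf_neq0.
have H := has_deriv0M (has_deriv0M (HB _ _ _ _ h1 h2) (HB _ _ _ _ h3 h4))
  (has_deriv0V n (has_deriv0M (HB _ _ _ _ h2 h3) (HB _ _ _ _ h4 h1))).
rewrite /cross_ratio; set d := (X in has_deriv0 _ X).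
apply: (eq_rect _ _ H); rewrite /d; field.
by rewrite n41 n34 n23 n12.
Qed.

End Changes.

(** * Circles moved by a Moebius field *)

Section MoebiusField.
Variable R : realType.
Implicit Types (A B : 'M[R[i]]_2) (c e z : R[i]) (r s : R).

(** The determinant in [moebius_field] written as a quadratic polynomial, for plain matrices, so
    that it applies directly to differences of face matrices. *)
Definition sl2_field A z := A 0 0 * z + A 0 1 - z * (A 1 0 * z + A 1 1).

Lemma det_mx22 (F : comNzRingType) (M : 'M[F]_2) :
  \det M = M 0 0 * M 1 1 - M 0 1 * M 1 0.
Proof.
rewrite (expand_det_row _ 0) !big_ord_recl big_ord0 addr0 /cofactor !det_mx11.
rewrite !mxE /= expr0 mul1r expr1 mulN1r mulrN.
by congr (M _ _ * M _ _ - M _ _ * M _ _); apply/val_inj.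
Qed.

Lemma tr0_mx22 A : \tr A = 0 -> A 1 1 = - A 0 0.
Proof.
rewrite /mxtrace !big_ord_recl big_ord0 addr0.
have -> : lift ord0 ord0 = 1 :> 'I_2 by apply/val_inj.
by move/eqP; rewrite addrC addr_eq0 => /eqP.
Qed.

Lemma moebius_fieldE (Psi : sl2 R) z : moebius_field Psi z = sl2_field (val Psi) z.
Proof.
rewrite /moebius_field /sl2_field det_mx22.
set h := homogeneous z; set Ah := val Psi *m h.
have M0 i : (row_mx Ah h : 'M_2) i 0 = val Psi i 0 * z + val Psi i 1.
  transitivity (Ah i 0); last first.
    rewrite mxE !big_ord_recl big_ord0 addr0 !mxE /= mulr1.
    by congr (_ * _ + val Psi _ _); apply/val_inj.
  by rewrite -(row_mxEl Ah h); congr (row_mx _ _ _ _); apply/val_inj.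
have M1 i : (row_mx Ah h : 'M_2) i 1 = h i 0.
  by rewrite -(row_mxEr Ah h); congr (row_mx _ _ _ _); apply/val_inj.
by rewrite !M0 !M1 !mxE /= mulr1.
Qed.

Lemma sl2_fieldB A B z : sl2_field (A - B) z = sl2_field A z - sl2_field B z.
Proof. by rewrite /sl2_field !mxE; ring. Qed.

Lemma conjcD (x y : R[i]) : (x + y)^* = x^* + y^*.
Proof. exact: rmorphD. Qed.

Lemma conjcN (x : R[i]) : (- x)^* = - x^*.
Proof. exact: rmorphN. Qed.

Lemma conjcM (x y : R[i]) : (x * y)^* = x^* * y^*.
Proof. exact: rmorphM. Qed.

Definition conjcE := (conjc_nat, conjcD, conjcN, conjcM, conjc_inv, conjc_real, conjcK).

Lemma dotC_Re (x y : R[i]) : dotC x y = complex.Re (x * y^*).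
Proof. by case: x y => [a b] [c d]; rewrite /dotC /=; ring. Qed.

Lemma Re_eq0 (x : R[i]) : complex.Re x = 0 <-> x + x^* = 0.
Proof.
split=> [x0|]; first by rewrite addcJ x0 mulr0.
by rewrite addcJ => /eqP; rewrite mulf_eq0 pnatr_eq0 /= => /eqP/complexI.
Qed.

Lemma complex_real_conj (x : R[i]) : x^* = x -> x = (complex.Re x)%:C.
Proof. by move=> xJ; rewrite ReJ_add xJ; field. Qed.

(* With A = [a b; g -a], the field b + 2 a z - g z^2 moves the circle of center c and radius r, to
   first order, to a circle: the normal velocity at c + r e is
   Re ((sl2_field A c - r^2 g^* ) e^* ) + r Re (sl2_field A)'(c). *)
Definition circle_center_change A c r : R[i] := sl2_field A c - r%:C ^+ 2 * (A 1 0)^*.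

Definition circle_radius_change A c r : R :=
  r * complex.Re (A 0 0 - A 1 1 - 2 * A 1 0 * c).

Definition moebius_variation (V : finType) A (P : circles R V) :=
  Variation (fun u => circle_center_change A (center P u) (radius P u))
            (fun u => circle_radius_change A (center P u) (radius P u)).

End MoebiusField.

(** * Two tangent circles *)

Section Edge.
Variables (R : realType) (V : finType) (P : circles R V).
Implicit Types (D : variation R V) (u v s t : V) (A : 'M[R[i]]_2).

Definition tangent u v :=
  [/\ 0 < radius P u, 0 < radius P v
    & `|center P v - center P u| = (radius P u + radius P v)%:C].

(** For tangent circles this is the unit vector from [c_u] to [c_v]. Its conjugate is its inverse,
    which turns metric statements into rational identities that [field] can decide. *)
Definition axis u v : R[i] :=
  (center P v - center P u) / (radius P u + radius P v)%:C.

Lemma tangent_sym u v : tangent u v -> tangent v u.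
Proof. by case=> ? ? ?; split=> //; rewrite distrC [radius P v + _]addrC. Qed.

Lemma tangent_neq0 u v : tangent u v ->
  [/\ (radius P u)%:C != 0, (radius P v)%:C != 0 &
      (radius P u)%:C + (radius P v)%:C != 0].
Proof.
case=> u0 v0 _; split; rewrite -?rmorphD fmorph_eq0 gt_eqF //.
exact: addr_gt0.
Qed.

Lemma radii_neq0 u v : tangent u v -> radius P u + radius P v != 0.
Proof. by case=> u0 v0 _; rewrite gt_eqF ?addr_gt0. Qed.

Lemma axis_conj u v : tangent u v -> (axis u v)^* = (axis u v)^-1.
Proof.
move=> uv; have [_ _ S0] := tangent_neq0 uv; case: uv => u0 v0 uv.
have e1 : axis u v * (axis u v)^* = 1.
  rewrite -sqr_normc normf_div uv ger0_norm.
    by rewrite divff ?expr1n // rmorphD.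
  by rewrite ler0c ltW // addr_gt0.
have e0 : axis u v != 0.
  by apply: contra_eq_neq e1 => ->; rewrite mul0r eq_sym oner_neq0.
by rewrite -[LHS]mul1r -(mulVf e0) -mulrA e1 mulr1.
Qed.

Lemma axis_neq0 u v : tangent u v -> axis u v != 0.
Proof.
move=> uv; have S0 := radii_neq0 uv; case: uv => u0 v0 uv.
rewrite mulf_neq0 ?invr_eq0 ?fmorph_eq0 // -normr_eq0 uv fmorph_eq0 //.
Qed.

Lemma center_axis u v : tangent u v ->
  center P v = center P u + ((radius P u)%:C + (radius P v)%:C) * axis u v.
Proof.
move=> uv; have [_ _ S0] := tangent_neq0 uv.
by rewrite /axis rmorphD; field.
Qed.

Lemma tangency_axis u v : tangent u v ->
  tangency_point P u v = center P u + (radius P u)%:C * axis u v.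
Proof.
move=> uv; rewrite /tangency_point /axis rmorphM fmorphV /=.
by rewrite -mulrA [_^-1 * _]mulrC.
Qed.

Lemma axis_sym u v : axis v u = - axis u v.
Proof. by rewrite /axis -[center P u - _]opprB mulNr [radius P v + _]addrC. Qed.

Lemma tangency_sym u v : tangent u v -> tangency_point P v u = tangency_point P u v.
Proof.
move=> uv; rewrite !tangency_axis //; last exact: tangent_sym.
by rewrite axis_sym (center_axis uv); ring.
Qed.

Lemma tangency_changeE D u v : tangent u v ->
  tangency_change P D u v =
    ((radius P v)%:C * dcenter D u + (radius P u)%:C * dcenter D v +
      ((dradius D u)%:C * (radius P v)%:C - (radius P u)%:C * (dradius D v)%:C)
        * axis u v) / ((radius P u)%:C + (radius P v)%:C).
Proof.
move=> uv; have [_ _ S0] := tangent_neq0 uv.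
rewrite /tangency_change /axis !(rmorphM, rmorphB, rmorphD, fmorphV, rmorphXn) /=.
by field.
Qed.

Definition tangency_preserved D u v :=
  dotC (dcenter D v - dcenter D u) (center P v - center P u)
    = (dradius D u + dradius D v) * (radius P u + radius P v).

(** Twice the inner product with a unit vector [e] is [w / e + w^* e]; in this form the condition is
    rational in the axis. *)
Lemma tangency_preservedE D u v : tangent u v ->
  tangency_preserved D u v <->
  (dcenter D v - dcenter D u) / axis u v
    + (dcenter D v - dcenter D u)^* * axis u v =
  2 * ((dradius D u)%:C + (dradius D v)%:C).
Proof.
move=> uv; have [_ _ S0] := tangent_neq0 uv; have e0 := axis_neq0 uv.
have S1 := radii_neq0 uv.
rewrite /tangency_preserved dotC_Re (center_axis uv).
set w := dcenter D v - dcenter D u.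
have -> : w * (center P u + ((radius P u)%:C + (radius P v)%:C) * axis u v
    - center P u)^* = (radius P u + radius P v)%:C * (w / axis u v).
  have -> : center P u + ((radius P u)%:C + (radius P v)%:C) * axis u v
    - center P u = (radius P u + radius P v)%:C * axis u v by rewrite rmorphD; ring.
  by rewrite conjcM conjc_real axis_conj //; ring.
have -> : complex.Re ((radius P u + radius P v)%:C * (w / axis u v))
    = complex.Re (w / axis u v) * (radius P u + radius P v).
  by case: (w / _) => a b /=; ring.
have -> : w^* * axis u v = (w / axis u v)^*.
  by rewrite conjcM conjc_inv axis_conj // invrK.
rewrite addcJ -rmorphD; split=> [/(mulIf S1) -> //|].
by move/(mulfI _)/complexI => ->; rewrite ?pnatr_eq0.
Qed.

End Edge.

(** * Moebius fields on tangent circles, and rigidity of a face *)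

Section EdgeAlgebra.
Variables (R : realType) (V : finType) (P : circles R V).
Implicit Types (D : variation R V) (u v s t : V) (A : 'M[R[i]]_2).

Lemma circle_radius_changeC A c (r : R) :
  (circle_radius_change A c r)%:C =
  r%:C * ((A 0 0 - A 1 1 - 2 * A 1 0 * c)
          + ((A 0 0)^* - (A 1 1)^* - 2 * (A 1 0)^* * c^*)) / 2.
Proof.
by rewrite /circle_radius_change rmorphM /= ReJ_add !conjcE mulrA.
Qed.

(** The moved circles still touch at the image of their tangency point, so this point follows the
    field. *)
Lemma moebius_tangency_change A u v : tangent P u v ->
  tangency_change P (moebius_variation A P) u v = sl2_field A (tangency_point P u v).
Proof.
move=> uv; have [_ _ S0] := tangent_neq0 uv.
rewrite tangency_changeE // tangency_axis //= !circle_radius_changeC.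
rewrite /circle_center_change /sl2_field (center_axis uv).
have := axis_conj uv; have := axis_neq0 uv; move: (axis P u v) => e e0 eJ.
rewrite !conjcE eJ.
field. by rewrite S0 e0.
Qed.

Lemma moebius_tangency_preserved A u v : tangent P u v ->
  tangency_preserved P (moebius_variation A P) u v.
Proof.
move=> uv; apply/tangency_preservedE => //=; rewrite !circle_radius_changeC.
rewrite /circle_center_change /sl2_field (center_axis uv).
have := axis_conj uv; have := axis_neq0 uv; move: (axis P u v) => e e0 eJ.
rewrite !expr2 !conjcE eJ.
by field.
Qed.

(* A change fixing the tangency point rotates both circles about it, with
   angular speed t / i. *)
Lemma tangency_fixed D u v : tangent P u v -> tangency_preserved P D u v ->
  tangency_change P D u v = 0 ->
  exists t : R[i], [/\ t^* = - t,
    dcenter D u = - ((dradius D u)%:C + (radius P u)%:C * t) * axis P u v &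
    dcenter D v = ((dradius D v)%:C + (radius P v)%:C * t) * axis P u v].
Proof.
move=> uv /(tangency_preservedE _ uv); have [u0 v0 S0] := tangent_neq0 uv.
rewrite (tangency_changeE D uv); have := axis_conj uv; have := axis_neq0 uv.
move: (axis P u v) => e e0 eJ.
move=> pres /eqP; rewrite mulf_eq0 invr_eq0 (negPf S0) orbF => /eqP eq0.
(* The formula for [dcenter D v] is solved for [t]. The fixed tangency point then gives the formula
   at [u], and preserved tangency makes [t] imaginary. *)
pose t := (dcenter D v / e - (dradius D v)%:C) / (radius P v)%:C.
have dv : dcenter D v = ((dradius D v)%:C + (radius P v)%:C * t) * e.
  by rewrite /t; field; rewrite e0 v0.
have du : dcenter D u = - ((dradius D u)%:C + (radius P u)%:C * t) * e.
  apply: (mulfI v0); apply/eqP; rewrite -subr_eq0 -eq0 dv; apply/eqP; ring.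
move: t dv du => t dv du; exists t; split=> //; apply: (mulfI S0).
apply/eqP; rewrite -subr_eq0; apply/eqP.
move: pres; rewrite du dv !conjcE eJ => /eqP; rewrite -subr_eq0 => /eqP <-.
by field.
Qed.

(** A circle passing through two fixed points moves in a pencil, and its tangents at these points
    turn in opposite directions. Algebraically, subtracting [e1 e2] times the conjugate equation
    eliminates [rho]. One axis points into the circle and the other out of it, so [e1 + e2 != 0]
    says that the two points are distinct. *)
Lemma rotation_sum0 (rho r t1 t2 e1 e2 : R[i]) : r != 0 -> e1 != 0 -> e2 != 0 ->
  e1 + e2 != 0 -> rho^* = rho -> r^* = r -> t1^* = - t1 -> t2^* = - t2 ->
  e1^* = e1^-1 -> e2^* = e2^-1 ->
  (rho + r * t1) * e1 = - (rho + r * t2) * e2 -> t1 + t2 = 0.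
Proof.
move=> r0 e10 e20 e120 rhoJ rJ t1J t2J e1J e2J E.
have := congr1 (@conjc R) E; rewrite !conjcE rhoJ rJ t1J t2J e1J e2J => EJ.
have H : r * (e1 + e2) * (t1 + t2) = 0.
  transitivity (((rho + r * t1) * e1 + (rho + r * t2) * e2)
    - e1 * e2 * ((rho + r * - t1) * e1^-1 + (rho + r * - t2) * e2^-1)).
    by field; rewrite e10 e20.
  by rewrite E EJ; ring.
by move/eqP: H; rewrite mulf_eq0 mulf_eq0 (negPf r0) (negPf e120) => /eqP.
Qed.

Lemma rigid_face D u v s : tangent P u v -> tangent P v s -> tangent P s u ->
  axis P u v + axis P s u != 0 -> axis P u v + axis P v s != 0 ->
  axis P v s + axis P s u != 0 ->
  (forall a b, (a, b) \in [:: (u, v); (v, s); (s, u)] ->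
     tangency_preserved P D a b /\ tangency_change P D a b = 0) ->
  dcenter D u = 0 /\ dradius D u = 0.
Proof.
move=> uv vs su n13 n12 n23 HD.
have [|p1 c1] := HD u v; first by rewrite !inE eqxx.
have [|p2 c2] := HD v s; first by rewrite !inE eqxx orbT.
have [|p3 c3] := HD s u; first by rewrite !inE eqxx !orbT.
have [t1 [t1J u1 v1]] := tangency_fixed uv p1 c1.
have [t2 [t2J v2 s2]] := tangency_fixed vs p2 c2.
have [t3 [t3J s3 u3]] := tangency_fixed su p3 c3.
have [u0 v0 _] := tangent_neq0 uv; have [_ s0 _] := tangent_neq0 vs.
have h13 : t3 + t1 = 0.
  have n31 : axis P s u + axis P u v != 0 by rewrite addrC.
  apply: (rotation_sum0 u0 (axis_neq0 su) (axis_neq0 uv) n31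
    (conjc_real (dradius D u)) (conjc_real _) t3J t1J (axis_conj su) (axis_conj uv)).
  by rewrite -u3 u1.
have h12 : t1 + t2 = 0.
  apply: (rotation_sum0 v0 (axis_neq0 uv) (axis_neq0 vs) n12
    (conjc_real (dradius D v)) (conjc_real _) t1J t2J (axis_conj uv) (axis_conj vs)).
  by rewrite -v1 v2.
have h23 : t2 + t3 = 0.
  apply: (rotation_sum0 s0 (axis_neq0 vs) (axis_neq0 su) n23
    (conjc_real (dradius D s)) (conjc_real _) t2J t3J (axis_conj vs) (axis_conj su)).
  by rewrite -s2 s3.
have t10 : t1 = 0.
  have : 2 * t1 = 0.
    transitivity ((t3 + t1) + (t1 + t2) - (t2 + t3)); first by ring.
    by rewrite h13 h12 h23; ring.
  by move/eqP; rewrite mulf_eq0 pnatr_eq0 => /eqP.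
have t30 : t3 = 0 by rewrite t10 addr0 in h13.
move: u1 u3; rewrite t10 t30 mulr0 addr0 => u1 u3.
(* Without rotation, the radius change of [C_u] would push its center away from two different points
   at once. *)
have : (dradius D u)%:C * (axis P u v + axis P s u) = 0.
  transitivity (dcenter D u - dcenter D u); last by rewrite subrr.
  by rewrite {1}u3 u1; ring.
move/eqP; rewrite mulf_eq0 (negPf n13) orbF fmorph_eq0 => /eqP r0.
by rewrite u1 r0 oppr0 mul0r.
Qed.

(** The generator of the parabolic transformations fixing [z]: its field has a double zero there. *)
Definition parabolic z : 'M[R[i]]_2 := mx2 z (- z ^+ 2) 1 (- z).

Lemma sl2_field_parabolic mu z w : sl2_field (mu *: parabolic z) w = - mu * (w - z) ^+ 2.
Proof.
by rewrite /sl2_field !mxE /=; ring.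
Qed.

Lemma matrix2_eq (A B : 'M[R[i]]_2) : A 0 0 = B 0 0 -> A 0 1 = B 0 1 ->
  A 1 0 = B 1 0 -> A 1 1 = B 1 1 -> A = B.
Proof.
move=> e00 e01 e10 e11; apply/matrixP => i j.
have I2 (k : 'I_2) : k = 0 \/ k = 1.
  by case: k => [[|[|//]] ?]; [left|right]; apply/val_inj.
by case: (I2 i) (I2 j) => -> [] ->.
Qed.

(** For [w = c_u + R_u f] with [f] of modulus 1 and [e] the axis, [(w - z)^2 = - |w - z|^2 e f].
    Hence the normal velocity of [C_u] at [w] is [|w - z|^2 Re(mu e)], and it vanishes when [mu e]
    is imaginary. *)
Lemma parabolic_fixes_circle mu u v : tangent P u v ->
  mu * axis P u v + (mu * axis P u v)^* = 0 ->
  let A := mu *: parabolic (tangency_point P u v) in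
  circle_center_change A (center P u) (radius P u) = 0 /\
  circle_radius_change A (center P u) (radius P u) = 0.
Proof.
move=> uv mu0 A.
have := axis_conj uv; have := axis_neq0 uv; have := tangency_axis uv.
move: mu0; rewrite conjcM; move: (axis P u v) => e mu0 z e0 eJ; split.
  rewrite /circle_center_change /A sl2_field_parabolic !mxE /= mulr1 z.
  transitivity (- (radius P u)%:C ^+ 2 * e * (mu * e + mu^* * e^*)).
    by rewrite eJ; field.
  by rewrite mu0 mulr0.
rewrite /circle_radius_change !mxE /= mulr1 z.
apply/eqP; rewrite mulf_eq0; apply/orP; right; apply/eqP/Re_eq0.
transitivity (2 * (radius P u)%:C * (mu * e + mu^* * e^*)).
  by rewrite !conjcE eJ; ring.
by rewrite mu0 mulr0.
Qed.

Lemma fixes_circles_parabolic A u v : tangent P u v -> \tr A = 0 ->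
  (forall w, w \in [:: u; v] ->
     circle_center_change A (center P w) (radius P w) = 0 /\
     circle_radius_change A (center P w) (radius P w) = 0) ->
  A = A 1 0 *: parabolic (tangency_point P u v) /\
  A 1 0 * axis P u v + (A 1 0 * axis P u v)^* = 0.
Proof.
move=> uv trA HA.
have [|cu ru] := HA u; first by rewrite !inE eqxx.
have [|cv rv] := HA v; first by rewrite !inE eqxx orbT.
(* The tangency point follows the field but depends only on the two circles, which do not move. *)
have fz : sl2_field A (tangency_point P u v) = 0.
  rewrite -(moebius_tangency_change A uv) tangency_changeE //= cu cv ru rv.
  by rewrite (rmorph0 (real_complex R)) !(mulr0, mul0r, subr0, addr0).
have A11 := tr0_mx22 trA.
have [u0 v0 S0] := tangent_neq0 uv.
have := tangency_axis uv; have := center_axis uv.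
have := axis_conj uv; have := axis_neq0 uv.
move: (axis P u v) => e e0 eJ cvE zE.
set z := tangency_point P u v in fz zE *.
(* Let [b] be the derivative of the field at [z]. Fixing [C_u] gives [b = - R_u g] and fixing [C_v]
   gives [b = R_v g], with opposite signs because the circles touch from opposite sides. So both
   vanish, and [z] is a double zero of the field. *)
pose g := A 1 0 * e + (A 1 0)^* * e^*.
pose b := 2 * A 0 0 - 2 * A 1 0 * z.
have bu : b = - (radius P u)%:C * g.
  move: fz cu; rewrite /circle_center_change => fz cu.
  have : (radius P u)%:C * e * (b + (radius P u)%:C * g)  = 0.
    transitivity (sl2_field A z
      - (sl2_field A (center P u) - (radius P u)%:C ^+ 2 * (A 1 0)^*)).
      by rewrite /sl2_field /b /g zE A11 eJ; field.
    by rewrite fz cu subr0.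
  move/eqP; rewrite !mulf_eq0 (negPf e0) (negPf u0) /= addr_eq0 => /eqP ->.
  by rewrite mulNr.
have bv : b = (radius P v)%:C * g.
  move: fz cv; rewrite /circle_center_change => fz cv.
  have : (radius P v)%:C * e * (b - (radius P v)%:C * g)  = 0.
    transitivity ((sl2_field A (center P v)
      - (radius P v)%:C ^+ 2 * (A 1 0)^*) - sl2_field A z).
      by rewrite /sl2_field /b /g cvE zE A11 eJ; field.
    by rewrite fz cv subr0.
  by move/eqP; rewrite !mulf_eq0 (negPf e0) (negPf v0) /= subr_eq0 => /eqP ->.
have g0 : g = 0.
  have : ((radius P u)%:C + (radius P v)%:C) * g = 0.
    by rewrite mulrDl -bv bu; ring.
  by move/eqP; rewrite mulf_eq0 (negPf S0) => /eqP.
have b0 : b = 0 by rewrite bv g0 mulr0.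
split; last by rewrite conjcM.
have a00 : A 0 0 = A 1 0 * z.
  apply: (@mulfI _ 2); first by rewrite pnatr_eq0.
  by apply/eqP; rewrite -subr_eq0 mulrA; apply/eqP.
apply: matrix2_eq; rewrite !mxE /= ?mulr1 //; last by rewrite A11 a00 mulrN.
by move: fz; rewrite /sl2_field A11 a00 => /eqP; rewrite -subr_eq0 => /eqP E;
  apply/eqP; rewrite -subr_eq0 -E; apply/eqP; ring.
Qed.

End EdgeAlgebra.

(** * Faces around a vertex *)

Section DiskCombinatorics.
Variables (V : finType) (G : triangulated_disk V).
Implicit Types (u v s t w x : V).

Lemma set3_rot u v s : [set u; v; s] = [set v; s; u].
Proof. by apply/setP => x; rewrite !inE -[in LHS]orbA orbC. Qed.

Lemma set3_swap u v s : [set u; v; s] = [set v; u; s].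
Proof. by rewrite [in LHS](setUC [set u]). Qed.

Lemma face_edges u v s : G u v s ->
  [/\ edge G u v, edge G v s & edge G s u].
Proof.
move=> f; have f' := face_rot f; have f'' := face_rot f'.
by split; apply/existsP; [exists s|exists u|exists v]; apply/orP; left.
Qed.

Lemma edge_face u v : edge G u v -> exists s, G u v s \/ G v u s.
Proof. by case/existsP => s /orP[]; exists s; [left|right]. Qed.

Lemma edge_sym u v : edge G u v -> edge G v u.
Proof. by case/existsP => s; rewrite orbC => h; apply/existsP; exists s. Qed.

Lemma interior_edgeP u v :
  reflect (exists s t, G u v s /\ G v u t) (interior_edge G u v).
Proof.
apply: (iffP andP) => [[/existsP[s ?] /existsP[t ?]]|[s [t [? ?]]]].
  by exists s, t.
by split; apply/existsP; [exists s|exists t].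
Qed.

Lemma apexE u v s : G u v s -> apex G u v = s.
Proof.
move=> f; rewrite /apex; case: pickP => [t g|/(_ s)]; last by rewrite f.
exact: (face_fun g f).
Qed.

Lemma left_faceE u v s : G u v s -> left_face G u v = [set u; v; s].
Proof. by move=> f; rewrite /left_face (apexE f). Qed.

Lemma right_faceE u v t : G v u t -> right_face G u v = [set u; v; t].
Proof. by move=> f; rewrite /right_face (left_faceE f) set3_swap. Qed.

(** * Functions on faces that agree across interior edges *)

Section Gluing.
Variables (T : Type) (f : {set V} -> T).

(** Consecutive vertices of a path in the link of [u] span a face with [u], so a path in the
    connected link passes from any face at [u] to any other through edges at [u]. *)
Lemma glue_vertex u :
  (forall v, interior_edge G u v ->
     f (left_face G u v) = f (right_face G u v)) ->
  forall v s w x, G u v s -> G u w x -> f [set u; v; s] = f [set u; w; x].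
Proof.
move=> jump.
pose r := [rel s t | G u s t || G u t s].
(* Two faces on the same side of [{u, w}] coincide by [face_fun]; two on opposite sides make the
   edge interior, and the hypothesis applies. *)
have adj w s s' : r w s -> r w s' -> f [set u; w; s] = f [set u; w; s'].
  have rot x y : G u x y -> G y u x by move=> /face_rot/face_rot.
  have mixed x y y' : G u x y -> G x u y' -> f [set u; x; y] = f [set u; x; y'].
    move=> g h; rewrite -(left_faceE g) -(right_faceE h); apply: jump.
    by apply/interior_edgeP; exists y, y'.
  move=> /orP[] g /orP[] h.
  - by rewrite (face_fun g h).
  - exact: mixed g (rot _ _ h).
  - by symmetry; apply: mixed h (rot _ _ g).
  - by rewrite (face_fun (rot _ _ g) (rot _ _ h)).
suff conn p v s w x : path r v p -> last v p = w -> r v s -> r w x ->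
    f [set u; v; s] = f [set u; w; x].
  move=> v s w x g h.
  have /connectP[p pp lp] : connect r v w.
    by apply: link_connected; have [] := face_edges g; have [] := face_edges h.
  by apply: conn pp _ _ _; rewrite //= ?g ?h.
elim: p v s => [|y p IH] v s /=.
  by move=> _ <-; apply: adj.
move=> /andP[vy yp] lw vs wx.
(* The face [{u, v, y}] contains both edges [{u, v}] and [{u, y}], so it links the start of the path
   to its tail. *)
rewrite (adj v s y vs vy) -(IH y v yp lw _ wx).
  by rewrite setUAC.
by rewrite /= orbC.
Qed.

Lemma glue_disk :
  (forall u v, interior_edge G u v ->
     f (left_face G u v) = f (right_face G u v)) ->
  forall u v s u' v' s', G u v s -> G u' v' s' ->
    f [set u; v; s] = f [set u'; v'; s'].
Proof.
move=> jump u v s u' v' s' g g'.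
have /connectP[p pp lp] := disk_connected G u u'.
elim: p u v s g pp lp => [|y p IH] u v s g /=.
  by move=> _ e; subst u'; apply: glue_vertex g g' => w; apply: jump.
(* A face at the edge [{u, y}] belongs to the stars of both [u] and [y]; gluing at [u] reaches it,
   and the induction continues from [y]. *)
case/andP => /edge_face[x uy] yp lp.
have glue := glue_vertex (jump _).
case: uy => uy.
  rewrite (glue _ _ _ _ _ g uy) set3_rot; apply: IH yp lp.
  exact: face_rot uy.
by rewrite (glue _ _ _ _ _ g (face_rot uy)) 2!set3_rot; apply: IH uy yp lp.
Qed.

End Gluing.

(** With [s = apex G u v], the left face of [e_uv] is the right face of [e_us]. Around an interior
    vertex the map from [v] to [s] permutes the neighbors, its inverse being [apex G ^~ u], so the
    sums over left and right faces are rearrangements of each other. *)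
Lemma sum_jump0 (M : zmodType) (g : {set V} -> M) u : interior_vertex G u ->
  \sum_(v | edge G u v) (g (left_face G u v) - g (right_face G u v)) = 0.
Proof.
move=> /forallP uint.
have {}uint v : edge G u v -> interior_edge G u v by move/(implyP (uint v)).
have apex_l v s : G u v s -> apex G s u = v.
  by move=> f; apply: apexE; do 2 apply: face_rot.
have apex_r w t : G w u t -> apex G u t = w.
  by move=> f; apply: apexE; apply: face_rot.
rewrite sumrB; apply/eqP; rewrite subr_eq0; apply/eqP; symmetry.
rewrite (reindex_onto (apex G u) (apex G ^~ u)) /=; last first.
  move=> w /uint/interior_edgeP[s [t [_ wut]]].
  by rewrite (apexE wut) (apex_r _ _ wut).
apply: eq_big => [v|v /andP[/uint/interior_edgeP[s [t [_ h]]] /eqP e]].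
  apply/andP/idP => [[/uint/interior_edgeP[s [t [_ h]]] /eqP <-]|].
    rewrite (apexE h); by have [] := face_edges h.
  move=> /uint/interior_edgeP[s [t [g1 _]]]; rewrite (apexE g1) (apex_l _ _ g1).
  by split=> //; apply: edge_sym; have [] := face_edges g1.
rewrite /right_face /left_face e; congr g.
by rewrite set3_rot.
Qed.

End DiskCombinatorics.

(** * Geometry of the faces of a packing *)

Section PackingGeometry.
Variables (R : realType) (V : finType) (G : triangulated_disk V).
Variables (P : circles R V) (packP : circle_packing G P).
Implicit Types (u v s t : V).

Definition cross (x y : R[i]) : R :=
  complex.Re x * complex.Im y - complex.Im x * complex.Re y.

Lemma edge_tangent u v : edge G u v -> tangent P u v.
Proof.
by move=> uv; split; [apply: radius_gt0 packP _|apply: radius_gt0 packP _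
  |apply: tangent_circles uv].
Qed.

Lemma face_tangent u v s : G u v s ->
  [/\ tangent P u v, tangent P v s & tangent P s u].
Proof. by case/face_edges => ? ? ?; split; apply: edge_tangent. Qed.

Lemma face_cross u v s : G u v s -> 0 < cross (axis P u v) (axis P u s).
Proof.
move=> f; have [uv _ su] := face_tangent f; have us := tangent_sym su.
have := ccw_faces packP f; rewrite /ccw.
have -> : center P v - center P u = (radius P u + radius P v)%:C * axis P u v.
  by rewrite (center_axis uv) rmorphD; ring.
have -> : center P s - center P u = (radius P u + radius P s)%:C * axis P u s.
  by rewrite (center_axis us) rmorphD; ring.
case: uv us => u0 v0 _ [_ s0 _].
set S := radius P u + radius P v; set T := radius P u + radius P s.
have ST : 0 < S * T by rewrite mulr_gt0 ?addr_gt0.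
rewrite /cross; case: (axis P u v) (axis P u s) => [a b] [c d] /=.
by move=> h; rewrite -(pmulr_rgt0 _ ST); lra.
Qed.

Lemma face_axis_neq u v s : G u v s -> axis P u v - axis P u s != 0.
Proof.
move=> f; apply: contraTneq (face_cross f) => /subr0_eq ->.
by rewrite /cross mulrC subrr ltxx.
Qed.

Lemma face_axis_sum u v s : G u v s -> axis P u v + axis P s u != 0.
Proof. by move=> f; rewrite (axis_sym P u s) face_axis_neq. Qed.

(** The two apexes lie on opposite sides of the line through [c_u] and [c_v]. This separates [z_k]
    from [z_m], so the denominator of [omega] is nonzero. *)
Lemma apexes_axis_neq u v s t : G u v s -> G v u t ->
  axis P u s - axis P u t != 0.
Proof.
move=> f /face_rot/face_cross h; apply/negP => /eqP/subr0_eq e.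
have := face_cross f; rewrite e => h'; have := addr_gt0 h h'.
by rewrite /cross addrACA [_ * complex.Im (axis P u t)]mulrC
  [_ * complex.Re (axis P u t)]mulrC; lra.
Qed.

Lemma tangency_diff u v s : tangent P u v -> tangent P u s ->
  tangency_point P u v - tangency_point P u s =
  (radius P u)%:C * (axis P u v - axis P u s).
Proof. by move=> uv us; rewrite !tangency_axis //; ring. Qed.

Lemma tangency_neq u v s : tangent P u v -> tangent P u s ->
  axis P u v - axis P u s != 0 ->
  tangency_point P u v != tangency_point P u s.
Proof.
move=> uv us n; rewrite -subr_eq0 tangency_diff // mulf_neq0 //.
by have [] := tangent_neq0 uv.
Qed.

Lemma face_tangency_neq u v s : G u v s ->
  tangency_point P u v != tangency_point P s u.
Proof.
move=> f; have [uv _ su] := face_tangent f; have us := tangent_sym su.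
by rewrite (tangency_sym us) tangency_neq // face_axis_neq.
Qed.

(** Partial fractions: [1 / omega] is a difference of images under [w -> 1 / (w - z_i)], so each
    adjacent face contributes a separate term. *)
Lemma omegaV u v s t : G u v s -> G v u t ->
  (omega G P u v)^-1 =
  (tangency_point P s u - tangency_point P u v)^-1
  - (tangency_point P t u - tangency_point P u v)^-1.
Proof.
move=> f g; have [uv _ su] := face_tangent f; have [_ ut _] := face_tangent g.
rewrite /omega (apexE f) (apexE g) (tangency_sym (tangent_sym su)) (tangency_sym ut).
have n1 : tangency_point P u s - tangency_point P u v != 0.
  by rewrite subr_eq0 eq_sym tangency_neq ?face_axis_neq //; apply: tangent_sym.
have n2 : tangency_point P u t - tangency_point P u v != 0.
  by rewrite subr_eq0 tangency_neq ?face_axis_neq //; apply: face_rot.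
have n3 : tangency_point P u t - tangency_point P u s != 0.
  rewrite subr_eq0 eq_sym tangency_neq ?(apexes_axis_neq f g) //.
  exact: tangent_sym.
field; by rewrite n1 n2 n3.
Qed.

Lemma omega_neq0 u v s t : G u v s -> G v u t -> omega G P u v != 0.
Proof.
move=> f g; have [uv _ su] := face_tangent f; have [_ ut _] := face_tangent g.
rewrite /omega (apexE f) (apexE g) (tangency_sym (tangent_sym su)) (tangency_sym ut).
rewrite !mulf_neq0 ?invr_eq0 // subr_eq0.
- by rewrite eq_sym tangency_neq ?face_axis_neq //; apply: tangent_sym.
- by rewrite tangency_neq ?face_axis_neq //; apply: face_rot.
- by rewrite eq_sym tangency_neq ?(apexes_axis_neq f g) //; apply: tangent_sym.
Qed.

(** The points [r (f - e)] lie on a circle through 0, which inversion maps to the line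
    [x^* + e^2 x = - e / r]. This equation does not involve [f], so differences of its points
    satisfy the homogeneous equation. *)
Lemma inv_diff_conj (r e f : R[i]) : r^* = r -> r != 0 -> e != 0 -> f != 0 ->
  f - e != 0 -> e^* = e^-1 -> f^* = f^-1 ->
  ((r * (f - e))^-1)^* = - r^-1 * e - (r * (f - e))^-1 * e ^+ 2.
Proof.
move=> rJ r0 e0 f0 fe eJ fJ.
have fe' : f^-1 - e^-1 != 0.
  have -> : f^-1 - e^-1 = - ((f - e) / (f * e)) by field; rewrite e0 f0.
  by rewrite oppr_eq0 mulf_neq0 ?invr_eq0 ?mulf_neq0.
rewrite !conjcE rJ eJ fJ.
have -> : (r * (f^-1 - e^-1))^-1 = - (r^-1 * ((f * e) / (f - e))).
  have -> : f^-1 - e^-1 = - ((f - e) / (f * e)) by field; rewrite e0 f0.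
  by field; rewrite e0 f0 r0 fe.
by field; rewrite r0 fe.
Qed.

(* The points (z_k - z_i)^-1 and (z_m - z_i)^-1 lie on the line onto which the
   inversion at z_i maps C_u, which is orthogonal to the conjugate of the axis. *)
Lemma omegaV_axis u v s t : G u v s -> G v u t ->
  (omega G P u v)^-1 * axis P u v + ((omega G P u v)^-1 * axis P u v)^* = 0.
Proof.
move=> f g; have [uv _ su] := face_tangent f; have [_ ut _] := face_tangent g.
have us := tangent_sym su.
rewrite (omegaV f g) (tangency_sym us) (tangency_sym ut) !tangency_diff //.
have [u0 _ _] := tangent_neq0 uv.
have n1 : axis P u s - axis P u v != 0.
  by rewrite -oppr_eq0 opprB face_axis_neq.
have n2 := face_axis_neq (face_rot g).
rewrite [(_ * axis P u v)^*]conjcM [(_ - _)^*]conjcD [(- _^-1)^*]conjcN.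
rewrite !inv_diff_conj ?axis_neq0 ?axis_conj ?conjc_real //.
have := axis_neq0 uv; move: (axis P u v) n1 n2 => e n1 n2 e0.
by field; rewrite n1 n2 u0 e0.
Qed.

(** Inversion at [z_i] maps [C_u] and [C_v] to parallel lines and [C_s] to a circle touching both,
    at antipodal points. The difference of these points is thus normal to the lines and depends only
    on [C_u] and [C_v]. *)
Lemma face_tangency_inv u v s : G u v s ->
  (tangency_point P s u - tangency_point P u v)^-1
  - (tangency_point P v s - tangency_point P u v)^-1
  = - ((radius P u)%:C^-1 + (radius P v)%:C^-1) / (2 * axis P u v).
Proof.
move=> f; have [uv vs su] := face_tangent f.
have f' := face_rot f; have f'' := face_rot f'.
have n13 := face_axis_sum f; have n12 := face_axis_sum f'.
have [u0 v0 S0] := tangent_neq0 uv; have [_ s0 _] := tangent_neq0 vs.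
have zk : tangency_point P s u - tangency_point P u v =
    - (radius P u)%:C * (axis P u v + axis P s u).
  rewrite (tangency_sym (tangent_sym su)) tangency_diff ?(axis_sym P s u) //.
    by ring.
  exact: tangent_sym.
have zj : tangency_point P v s - tangency_point P u v =
    (radius P v)%:C * (axis P v s + axis P u v).
  rewrite -(tangency_sym uv) tangency_diff ?(axis_sym P u v) //; first by ring.
  exact: tangent_sym.
rewrite zk zj.
(* The triangle of centers closes up. *)
have cl : (radius P u)%:C * (axis P u v + axis P s u)
   + (radius P v)%:C * (axis P v s + axis P u v)
   + (radius P s)%:C * (axis P s u + axis P v s) = 0.
  transitivity
    ((center P u + ((radius P u)%:C + (radius P v)%:C) * axis P u v - center P v)
    + (center P v + ((radius P v)%:C + (radius P s)%:C) * axis P v s - center P s)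
    + (center P s + ((radius P s)%:C + (radius P u)%:C) * axis P s u - center P u)).
    by ring.
  by rewrite -!center_axis // !subrr !addr0.
have := axis_neq0 uv; have := axis_neq0 vs; have := axis_neq0 su.
have := axis_conj uv; have := axis_conj vs; have := axis_conj su.
have uJ := conjc_real (radius P u); have vJ := conjc_real (radius P v).
have sJ := conjc_real (radius P s).
move: cl n13 n12 uJ vJ sJ u0 v0 {zk zj S0 s0}.
move: (axis P u v) (axis P v s) (axis P s u) => e1 e2 e3.
move: (radius P u)%:C (radius P v)%:C (radius P s)%:C => a b c.
move=> cl n13 n12 aJ bJ cJ a0 b0 e3J e2J e1J e30 e20 e10.
have := congr1 (@conjc R) cl; rewrite conjc0 !conjcE aJ bJ cJ e1J e2J e3J => clJ.
(* The radius of [C_s] is eliminated between the closing relation and its conjugate. *)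
have key : a * (e1 + e3) * (e1 - e2) + b * (e2 + e1) * (e1 - e3) = 0.
  transitivity (e1 * (a * (e1 + e3) + b * (e2 + e1) + c * (e3 + e2))
    - e1 * e2 * e3 * (a * (e1^-1 + e3^-1) + b * (e2^-1 + e1^-1)
      + c * (e3^-1 + e2^-1))); last by rewrite cl clJ !mulr0 subr0.
  by field; rewrite e10 e20 e30.
apply/eqP; rewrite -subr_eq0; apply/eqP.
transitivity (- (a * (e1 + e3) * (e1 - e2) + b * (e2 + e1) * (e1 - e3))
   / (2 * e1 * a * b * (e1 + e3) * (e2 + e1))); last by rewrite key oppr0 mul0r.
by field; rewrite e10 a0 b0 n13 n12.
Qed.

(** By [face_tangency_inv] the two faces yield the same vector, [k - j = m - n]; hence
    [n - j = - (k - m)]. *)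
Lemma omega_sym u v s t : G u v s -> G v u t -> omega G P v u = - omega G P u v.
Proof.
move=> f g; apply: invr_inj; rewrite invrN (omegaV g f) (omegaV f g).
have [uv vs su] := face_tangent f; have [_ ut tv] := face_tangent g.
have := face_tangency_inv f; have := face_tangency_inv g.
rewrite (tangency_sym uv) (tangency_sym (tangent_sym ut)) (axis_sym P u v).
rewrite (tangency_sym vs) (tangency_sym (tangent_sym su)) (tangency_sym ut).
rewrite (tangency_sym (tangent_sym tv)).
set zi := tangency_point P u v; set k := (tangency_point P u s - _)^-1.
set m := (tangency_point P u t - zi)^-1; set n := (_ - zi)^-1.
set j := (_ - zi)^-1; move=> h1 h2.
transitivity ((n - m) + (k - j) - (k - m)); first by ring.
rewrite h1 h2; have := axis_neq0 uv; have [u0 v0 _] := tangent_neq0 uv.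
by move: (axis P u v) => e e0; field; rewrite e0 u0 v0.
Qed.

End PackingGeometry.

(** * Deformations and jumps *)

Section Main.
Variables (R : realType) (V : finType) (G : triangulated_disk V).
Variables (P : circles R V) (packP : circle_packing G P) (Phi : {set V} -> sl2 R).
Implicit Types (D : variation R V) (u v s t : V) (A B : 'M[R[i]]_2).
Implicit Types (lambda : {set V} -> R).

Definition agree_at D D' u :=
  dcenter D u = dcenter D' u /\ dradius D u = dradius D' u.

Definition variation_sub D D' :=
  Variation (fun u => dcenter D u - dcenter D' u)
            (fun u => dradius D u - dradius D' u).

Lemma tangency_change_local D D' u v : agree_at D D' u -> agree_at D D' v ->
  tangency_change P D u v = tangency_change P D' u v.
Proof. by rewrite /tangency_change => -[-> ->] [-> ->]. Qed.

Lemma tangency_preserved_local D D' u v : agree_at D D' u -> agree_at D D' v ->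
  tangency_preserved P D' u v -> tangency_preserved P D u v.
Proof. by rewrite /tangency_preserved => -[-> ->] [-> ->]. Qed.

Lemma tangency_change_sub D D' u v : tangent P u v ->
  tangency_change P (variation_sub D D') u v =
  tangency_change P D u v - tangency_change P D' u v.
Proof.
move=> uv; rewrite !tangency_changeE //= !rmorphB /=.
by have [_ _ S0] := tangent_neq0 uv; field.
Qed.

Lemma tangency_change_sym D u v : tangent P u v ->
  tangency_change P D v u = tangency_change P D u v.
Proof.
move=> uv; rewrite !tangency_changeE //; last exact: tangent_sym.
have [_ _ S0] := tangent_neq0 uv; rewrite axis_sym.
by field.
Qed.

Lemma tangency_preserved_sub D D' u v :
  tangency_preserved P D u v -> tangency_preserved P D' u v ->
  tangency_preserved P (variation_sub D D') u v.
Proof.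
rewrite /tangency_preserved /dotC /= !raddfB /= => h h'.
rewrite [RHS](_ : _ = (dradius D u + dradius D v) * (radius P u + radius P v)
  - (dradius D' u + dradius D' v) * (radius P u + radius P v)); last by ring.
by rewrite -h -h'; ring.
Qed.

Lemma circle_changeB A B c (r : R) :
  circle_center_change (A - B) c r =
    circle_center_change A c r - circle_center_change B c r /\
  circle_radius_change (A - B) c r =
    circle_radius_change A c r - circle_radius_change B c r.
Proof.
split.
  by rewrite /circle_center_change sl2_fieldB !mxE conjcD conjcN; ring.
rewrite /circle_radius_change -mulrBr -raddfB !mxE; congr (_ * complex.Re _).
by ring.
Qed.

(** * From deformations to jumps *)

Lemma interior_edge_faces u v : interior_edge G u v ->
  exists s t, [/\ G u v s, G v u t, left_face G u v = [set u; v; s]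
    & right_face G u v = [set u; v; t]].
Proof.
case/interior_edgeP => s [t [f g]]; exists s, t; split=> //.
  exact: left_faceE.
exact: right_faceE.
Qed.

Lemma face_tangency_change D u v s : represents G P Phi D -> G u v s ->
  forall a b, (a, b) \in [:: (u, v); (v, s); (s, u)] ->
  tangency_change P D a b = sl2_field (val (Phi [set u; v; s])) (tangency_point P a b).
Proof.
move=> rep f a b; have [uv vs su] := face_tangent packP f.
have [h1 h2 h3] := rep _ _ _ f; rewrite -!moebius_fieldE.
by rewrite !inE => /or3P[] /eqP[-> ->]; rewrite -dtangency_pointE ?radii_neq0.
Qed.

(** Subtracting the Moebius variation leaves a change that preserves the tangencies of the face and
    fixes its tangency points, so [rigid_face] applies. Rotating the face gives the other two
    vertices. *)
Lemma represents_circle_change D u v s : infinitesimal_deformation G P D ->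
  represents G P Phi D -> G u v s ->
  agree_at D (moebius_variation (val (Phi [set u; v; s])) P) u.
Proof.
move=> def rep f; have [uv vs su] := face_tangent packP f.
have [euv evs esu] := face_edges f.
have f' := face_rot f; have f'' := face_rot f'.
set A := val _; set D' := moebius_variation A P.
have n12 : axis P u v + axis P v s != 0 by rewrite addrC (face_axis_sum packP f').
have n23 : axis P v s + axis P s u != 0 by rewrite addrC (face_axis_sum packP f'').
have [|c0 r0] := @rigid_face _ _ P (variation_sub D D') _ _ _ uv vs su
  (face_axis_sum packP f) n12 n23.
  move=> a b ab.
  have [tab eab] : tangent P a b /\ edge G a b.
    by move: ab; rewrite !inE => /or3P[] /eqP[-> ->].
  split.
    apply: tangency_preserved_sub; first exact: def.
    exact: moebius_tangency_preserved.
  rewrite tangency_change_sub // moebius_tangency_change //.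
  by rewrite (face_tangency_change rep f) // subrr.
by split; apply: subr0_eq.
Qed.

Lemma sl2_tr (Psi : sl2 R) : \tr (val Psi) = 0.
Proof. exact/eqP/(valP Psi). Qed.

Lemma represents_jump D u v : infinitesimal_deformation G P D ->
  represents G P Phi D -> interior_edge G u v ->
  let A := val (Phi (left_face G u v)) - val (Phi (right_face G u v)) in
  A = A 1 0 *: parabolic (tangency_point P u v) /\
  A 1 0 * axis P u v + (A 1 0 * axis P u v)^* = 0.
Proof.
move=> def rep /interior_edge_faces[s [t [f g -> ->]]] /=.
have [uv _ _] := face_tangent packP f.
apply: fixes_circles_parabolic => //; first by rewrite linearB /= !sl2_tr subrr.
have [f1 f2] := (face_rot f, face_rot (face_rot f)).
have [g1 g2] := (face_rot g, face_rot (face_rot g)).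
have H w : w \in [:: u; v] ->
   agree_at D (moebius_variation (val (Phi [set u; v; s])) P) w /\
   agree_at D (moebius_variation (val (Phi [set u; v; t])) P) w.
  rewrite !inE => /orP[] /eqP ->; split.
  - exact: represents_circle_change f.
  - by have := represents_circle_change def rep g1; rewrite -set3_rot set3_swap.
  - by have := represents_circle_change def rep f1; rewrite -set3_rot.
  - by have := represents_circle_change def rep g; rewrite set3_swap.
move=> w /H[[/= c1 r1] [/= c2 r2]].
have [-> ->] := circle_changeB (val (Phi [set u; v; s])) (val (Phi [set u; v; t]))
  (center P w) (radius P w).
by split; apply/eqP; rewrite subr_eq0; apply/eqP; [rewrite -c1 -c2|rewrite -r1 -r2].
Qed.

(** Both [mu e] and [e / omega] are imaginary, where [e] is the axis; their quotient [mu omega] is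
    therefore real. *)
Lemma real_div_omega (mu : R[i]) u v : interior_edge G u v ->
  mu * axis P u v + (mu * axis P u v)^* = 0 ->
  mu = (complex.Re (mu * omega G P u v))%:C / omega G P u v.
Proof.
move=> /interior_edgeP[s [t [f g]]] mu0.
have [uv _ _] := face_tangent packP f.
have o0 := omega_neq0 packP f g.
rewrite -complex_real_conj ?mulfK //.
have := omegaV_axis packP f g; move: mu0.
rewrite [(mu * _)^*]conjcM [(_^-1 * _)^*]conjcM conjc_inv axis_conj //.
have := axis_neq0 uv; move: (axis P u v) => e e0.
move: (omega G P u v) o0 => o o0 mu0 oJ0.
have oJ0' : o^* != 0 by rewrite conjc_eq0.
have muE : mu^* = - mu * e ^+ 2.
  apply/eqP; rewrite -subr_eq0; apply/eqP.
  by transitivity (e * (mu * e + mu^* / e)); [field|rewrite mu0 mulr0].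
have oE : o^*^-1 = - o^-1 * e ^+ 2.
  apply/eqP; rewrite -subr_eq0; apply/eqP.
  transitivity (e * (o^-1 * e + o^*^-1 / e)); last by rewrite oJ0 mulr0.
  by move: (o^*) oJ0' => o' o'0; field; rewrite e0 o'0 o0.
by rewrite conjcM muE -[o^*]invrK oE; field; rewrite e0 o0.
Qed.

(** The lower left entry of [parabolic z] is 1, so that entry of the jump is the whole coefficient,
    and multiplying by [omega] recovers [lambda]. *)
Definition jump_coef u v : R :=
  complex.Re ((val (Phi (left_face G u v)) - val (Phi (right_face G u v))) 1 0
    * omega G P u v).

(** Reversing the edge exchanges the two faces and negates [omega], so the signs cancel. *)
Lemma jump_coef_sym u v : interior_edge G u v -> jump_coef v u = jump_coef u v.
Proof.
move=> /interior_edgeP[s [t [f g]]]; rewrite /jump_coef (omega_sym packP f g).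
by rewrite /right_face -opprB mxE mulrNN.
Qed.

(** An orientation of the edge is picked, and [jump_coef_sym] makes the choice immaterial; 0 is a
    default away from interior edges. *)
Definition jump_lambda (S : {set V}) : R :=
  if [pick e | interior_edge G e.1 e.2 && (S == [set e.1; e.2])] is Some e
  then jump_coef e.1 e.2 else 0.

Lemma set2_eq u v a b : [set u; v] = [set a; b] ->
  (a, b) = (u, v) \/ (a, b) = (v, u).
Proof.
move=> E.
have : a \in [set u; v] by rewrite E set21.
have : b \in [set u; v] by rewrite E set22.
have : u \in [set a; b] by rewrite -E set21.
have : v \in [set a; b] by rewrite -E set22.
by rewrite !inE => /orP[] /eqP-> /orP[] /eqP-> /orP[] /eqP ? /orP[] /eqP ?; subst; auto.
Qed.

Lemma jump_lambdaE u v : interior_edge G u v ->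
  jump_lambda [set u; v] = jump_coef u v.
Proof.
move=> uv; rewrite /jump_lambda; case: pickP => [[a b] /= /andP[ab /eqP E]|].
  by have [[-> ->]|[-> ->]] := set2_eq E; rewrite // jump_coef_sym.
by move/(_ (u, v)); rewrite /= uv eqxx.
Qed.

Lemma represents_jump_condition D : infinitesimal_deformation G P D ->
  represents G P Phi D -> jump_condition G P Phi jump_lambda.
Proof.
move=> def rep u v uv /=; have [AE A0] := represents_jump def rep uv.
rewrite jump_lambdaE // -real_div_omega //.
Qed.

(** * From jumps to deformations *)

Lemma jump_circle_change lambda u v : jump_condition G P Phi lambda ->
  interior_edge G u v ->
  let A := val (Phi (left_face G u v)) in let B := val (Phi (right_face G u v)) in
  circle_center_change A (center P u) (radius P u) =
    circle_center_change B (center P u) (radius P u) /\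
  circle_radius_change A (center P u) (radius P u) =
    circle_radius_change B (center P u) (radius P u).
Proof.
move=> jump uv A B; have := jump u v uv; rewrite -/A -/B /= -/(parabolic _) => AB.
have /interior_edgeP[s [t [f g]]] := uv.
have [tuv _ _] := face_tangent packP f.
have /= := parabolic_fixes_circle (mu := (lambda [set u; v])%:C / omega G P u v) tuv.
rewrite -AB; have [-> ->] := circle_changeB A B (center P u) (radius P u).
case.
  (* Since [lambda] is real, it factors out of the sum with the conjugate, and [omegaV_axis] makes
     the rest vanish. *)
  transitivity ((lambda [set u; v])%:C * ((omega G P u v)^-1 * axis P u v
     + ((omega G P u v)^-1 * axis P u v)^*)).
    rewrite -mulrA conjcM conjc_real; ring.
  by rewrite (omegaV_axis packP f g) mulr0.
by split; apply: subr0_eq.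
Qed.

(** Some face at [u]; the default [set0] is never reached because every vertex lies in a face. *)
Definition face_at u : {set V} :=
  if [pick p | G u p.1 p.2] is Some p then [set u; p.1; p.2] else set0.

Definition glued_variation :=
  Variation
    (fun u => circle_center_change (val (Phi (face_at u))) (center P u) (radius P u))
    (fun u => circle_radius_change (val (Phi (face_at u))) (center P u) (radius P u)).

Lemma glued_agree lambda u v s : jump_condition G P Phi lambda -> G u v s ->
  agree_at glued_variation (moebius_variation (val (Phi [set u; v; s])) P) u.
Proof.
move=> jump f; rewrite /agree_at /= /face_at.
case: pickP => [[v' s'] /= f'|/(_ (v, s))]; last by rewrite /= f.
(* What is glued around [u] is the motion of [C_u] under each face matrix; the matrix itself may
   jump. *)
pose h F := (circle_center_change (val (Phi F)) (center P u) (radius P u),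
             circle_radius_change (val (Phi F)) (center P u) (radius P u)).
suff [-> ->] : h [set u; v'; s'] = h [set u; v; s] by [].
apply: (glue_vertex (G := G)) f' f => w uw.
by rewrite /h; have [-> ->] := jump_circle_change jump uw.
Qed.

Lemma glued_agree_face lambda u v s : jump_condition G P Phi lambda -> G u v s ->
  forall w, w \in [:: u; v; s] ->
  agree_at glued_variation (moebius_variation (val (Phi [set u; v; s])) P) w.
Proof.
move=> jump f w; rewrite !inE => /or3P[] /eqP ->.
- exact: glued_agree jump f.
- by have := glued_agree jump (face_rot f); rewrite -set3_rot.
- by have := glued_agree jump (face_rot (face_rot f)); rewrite -2!set3_rot.
Qed.

(** Every edge lies in a face, and the single matrix of that face moves the circles at both ends. *)
Lemma glued_deformation lambda : jump_condition G P Phi lambda ->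
  infinitesimal_deformation G P glued_variation.
Proof.
move=> jump u v uv.
have tuv : tangent P u v := edge_tangent packP uv.
have [A [Hu Hv]] : exists A, agree_at glued_variation (moebius_variation A P) u
    /\ agree_at glued_variation (moebius_variation A P) v.
  have [s [f|f]] := edge_face uv; have H := glued_agree_face jump f.
    by exists (val (Phi [set u; v; s])); split; apply: H; rewrite !inE eqxx ?orbT.
  by exists (val (Phi [set v; u; s])); split; apply: H; rewrite !inE eqxx ?orbT.
exact: tangency_preserved_local Hu Hv (moebius_tangency_preserved A tuv).
Qed.

Lemma glued_represents lambda : jump_condition G P Phi lambda ->
  represents G P Phi glued_variation.
Proof.
move=> jump u v s f /=; have [uv vs su] := face_tangent packP f.
have H := glued_agree_face jump f.
have [Hu Hv Hs] : [/\ agree_at glued_variation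
    (moebius_variation (val (Phi [set u; v; s])) P) u,
    agree_at glued_variation
    (moebius_variation (val (Phi [set u; v; s])) P) v &
    agree_at glued_variation
    (moebius_variation (val (Phi [set u; v; s])) P) s].
  by split; apply: H; rewrite !inE eqxx ?orbT.
have E a b : tangent P a b ->
    agree_at glued_variation (moebius_variation (val (Phi [set u; v; s])) P) a ->
    agree_at glued_variation (moebius_variation (val (Phi [set u; v; s])) P) b ->
    dtangency_point P glued_variation a b =
    moebius_field (Phi [set u; v; s]) (tangency_point P a b).
  move=> ab Ha Hb; rewrite dtangency_pointE ?radii_neq0 //.
  by rewrite (tangency_change_local Ha Hb) moebius_tangency_change // moebius_fieldE.
by split; apply: E.
Qed.

(** * The Koebe conditions and the change of the cross ratios *)

Lemma jump_koebe lambda : jump_condition G P Phi lambda ->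
  koebe_quadratic_differential G P lambda.
Proof.
move=> jump u uint.
(* Taking for [c] the entries of a matrix gives the three Koebe sums, as [parabolic z_i] has entries
   [1], [z_i] and [- z_i^2]. *)
have sum0 (c : 'M[R[i]]_2 -> R[i]) : additive c ->
   \sum_(v | edge G u v) c (((lambda [set u; v])%:C / omega G P u v)
      *: parabolic (tangency_point P u v)) = 0.
  move=> cadd; rewrite -[RHS](sum_jump0 (fun F => c (val (Phi F))) uint).
  apply: eq_bigr => v uv; rewrite /parabolic -jump.
    exact: cadd.
  by have /forallP/(_ v)/implyP := uint; apply.
split.
- rewrite -[RHS](sum0 (fun A => A 1 0)); last by move=> A B; rewrite !mxE.
  by apply: eq_bigr => v _; rewrite !mxE /= mulr1.
- rewrite -[RHS](sum0 (fun A => A 0 0)); last by move=> A B; rewrite !mxE.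
  by apply: eq_bigr => v _; rewrite !mxE /=.
- apply: oppr_inj; rewrite oppr0 -sumrN.
  rewrite -[RHS](sum0 (fun A => A 0 1)); last by move=> A B; rewrite !mxE.
  by apply: eq_bigr => v _; rewrite !mxE /= mulrN.
Qed.

Lemma dcr_daggerE D u v s t : G u v s -> G v u t ->
  let zi := tangency_point P u v in let zj := tangency_point P v s in
  let zk := tangency_point P s u in let zm := tangency_point P t u in
  let di := tangency_change P D u v in let dj := tangency_change P D v s in
  let dk := tangency_change P D s u in let dm := tangency_change P D t u in
  zi != zj -> zj != zk -> zk != zm -> zm != zi ->
  dcr_dagger G P D u v = cross_ratio zi zj zk zm *
    ((di - dj) / (zi - zj) - (dj - dk) / (zj - zk)
     + (dk - dm) / (zk - zm) - (dm - di) / (zm - zi)).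
Proof.
move=> f g zi zj zk zm di dj dk dm nij njk nkm nmi.
have [uv vs su] := face_tangent packP f; have [_ ut _] := face_tangent packP g.
have hd a b (ab : tangent P a b) := has_deriv0_tangency D (radii_neq0 ab).
rewrite /dcr_dagger /first_order_change /cr_dagger (apexE f) (apexE g).
have := has_deriv0_cross_ratio (hd _ _ uv) (hd _ _ vs) (hd _ _ su)
  (hd _ _ (tangent_sym ut)).
rewrite deform0 => /(_ nij njk nkm nmi) h.
exact: has_deriv0E h.
Qed.

Lemma jump_cr_dagger D lambda : represents G P Phi D ->
  jump_condition G P Phi lambda -> forall u v, interior_edge G u v ->
  (lambda [set u; v])%:C = dcr_dagger G P D u v / cr_dagger G P u v.
Proof.
move=> rep jump u v uv; have /= := jump u v uv.
have [s [t [f g -> ->]]] := interior_edge_faces uv.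
have [tuv vs su] := face_tangent packP f; have [_ ut _] := face_tangent packP g.
rewrite -/(parabolic _).
set A := val _; set B := val _; set mu := (X in X *: _) => AB.
have nij : tangency_point P u v != tangency_point P v s.
  by rewrite eq_sym (face_tangency_neq packP (face_rot f)).
have njk : tangency_point P v s != tangency_point P s u.
  by rewrite eq_sym (face_tangency_neq packP (face_rot (face_rot f))).
have nmi : tangency_point P t u != tangency_point P u v.
  rewrite (tangency_sym ut) tangency_neq //.
  exact: (face_axis_neq packP (face_rot g)).
have nkm : tangency_point P s u != tangency_point P t u.
  rewrite (tangency_sym ut) (tangency_sym (tangent_sym su)) tangency_neq //.
    exact: tangent_sym.
  exact: apexes_axis_neq f g.
rewrite (dcr_daggerE D f g) // /cr_dagger (apexE f) (apexE g).
have di := face_tangency_change rep f.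
(* [z_m] moves with [B], which differs from [A] by [mu] times a parabolic matrix; this is the only
   deviation from the field of [A]. *)
have dm : tangency_change P D t u = sl2_field A (tangency_point P t u)
    + mu * (tangency_point P t u - tangency_point P u v) ^+ 2.
  have dut : tangency_change P D u t = sl2_field B (tangency_point P u t).
    rewrite (face_tangency_change rep g) ?inE ?eqxx ?orbT //.
    by rewrite set3_swap.
  rewrite tangency_change_sym // dut (tangency_sym ut).
  have /= := congr1 (fun M => sl2_field M (tangency_point P u t)) AB.
  rewrite sl2_fieldB sl2_field_parabolic -/B => /eqP; rewrite subr_eq => /eqP ->.
  by ring.
have d1 := di u v (mem_head _ _).
have d2 : tangency_change P D v s = sl2_field A (tangency_point P v s).
  by apply: di; rewrite !inE eqxx orbT.
have d3 : tangency_change P D s u = sl2_field A (tangency_point P s u).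
  by apply: di; rewrite !inE eqxx !orbT.
rewrite dm d1 d2 d3.
have -> : (lambda [set u; v])%:C = mu * omega G P u v.
  by rewrite /mu divfK // (omega_neq0 packP f g).
(* In the logarithmic derivative the terms of [A] cancel by Moebius invariance, and the extra motion
   of [z_m] contributes exactly [mu omega]. *)
rewrite /omega (apexE f) (apexE g) /cross_ratio /sl2_field -/A.
clear -nij njk nmi nkm.
move: (tangency_point P u v) (tangency_point P v s) (tangency_point P s u)
  (tangency_point P t u) (A 0 0) (A 0 1) (A 1 0) (A 1 1) mu nij njk nmi nkm.
move=> i j k m a b c d mu; rewrite -(subr_eq0 i) => nij.
rewrite -(subr_eq0 j) => njk; rewrite -(subr_eq0 m) => nmi.
rewrite -(subr_eq0 k) => nkm.
have nmk : m - k != 0 by rewrite -opprB oppr_eq0.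
field.
by rewrite nij njk nmi nkm.
Qed.

(** * Deformations induced by a global Moebius transformation *)

Lemma sl2_field_eq0 A z1 z2 z3 : \tr A = 0 -> z1 != z2 -> z2 != z3 -> z3 != z1 ->
  sl2_field A z1 = 0 -> sl2_field A z2 = 0 -> sl2_field A z3 = 0 -> A = 0.
Proof.
move=> trA n12 n23 n31.
have A11 := tr0_mx22 trA.
rewrite /sl2_field A11 => f1 f2 f3.
have c0 : A 1 0 = 0.
  (* This combination of the three values isolates the quadratic coefficient, multiplied by a
     Vandermonde product. *)
  have : (z1 - z2) * ((z2 - z3) * ((z3 - z1) * A 1 0)) = 0.
    transitivity (
      (A 0 0 * z1 + A 0 1 - z1 * (A 1 0 * z1 - A 0 0)) * (z2 - z3) +
      (A 0 0 * z2 + A 0 1 - z2 * (A 1 0 * z2 - A 0 0)) * (z3 - z1) +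
      (A 0 0 * z3 + A 0 1 - z3 * (A 1 0 * z3 - A 0 0)) * (z1 - z2)).
      by ring.
    by rewrite f1 f2 f3; ring.
  by move/eqP; rewrite !mulf_eq0 !subr_eq0 (negPf n12) (negPf n23) (negPf n31) => /eqP.
have a0 : A 0 0 = 0.
  have : (z1 - z2) * (2 * A 0 0) = 0.
    transitivity (
      (A 0 0 * z1 + A 0 1 - z1 * (A 1 0 * z1 - A 0 0)) -
      (A 0 0 * z2 + A 0 1 - z2 * (A 1 0 * z2 - A 0 0))).
      by rewrite c0; ring.
    by rewrite f1 f2 subrr.
  by move/eqP; rewrite !mulf_eq0 subr_eq0 (negPf n12) pnatr_eq0 => /eqP.
apply: matrix2_eq; rewrite !mxE ?A11 ?c0 ?a0 ?oppr0 //.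
by move: f1; rewrite c0 a0 !(mul0r, subr0, mulr0, add0r).
Qed.

(** The two fields agree at the three distinct tangency points of the face, and such a field is
    determined by three values. *)
Lemma global_moebius_eq D (Psi : sl2 R) u v s : represents G P Phi D ->
  (forall u v, edge G u v ->
     dtangency_point P D u v = moebius_field Psi (tangency_point P u v)) ->
  G u v s -> val (Phi [set u; v; s]) = val Psi.
Proof.
move=> rep glob f; have [uv vs su] := face_edges f.
have [f1 f2] := (face_rot f, face_rot (face_rot f)).
apply: subr0_eq; apply: (@sl2_field_eq0 _ (tangency_point P u v)
  (tangency_point P v s) (tangency_point P s u)).
- by rewrite linearB /= !sl2_tr subrr.
- by rewrite eq_sym (face_tangency_neq packP f1).
- by rewrite eq_sym (face_tangency_neq packP f2).
- by rewrite eq_sym (face_tangency_neq packP f).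
all: have [h1 h2 h3] := rep _ _ _ f; rewrite sl2_fieldB -!moebius_fieldE.
- by rewrite -h1 -glob ?subrr.
- by rewrite -h2 -glob ?subrr.
- by rewrite -h3 -glob ?subrr.
Qed.

Lemma global_moebius_iff D lambda : represents G P Phi D ->
  jump_condition G P Phi lambda ->
  induced_by_global_moebius G P D <->
  (forall u v, interior_edge G u v -> lambda [set u; v] = 0).
Proof.
move=> rep jump; split=> [[Psi glob] u v uv|lambda0].
  have /= := jump u v uv.
  have [s [t [f g -> ->]]] := interior_edge_faces uv.
  rewrite [[set u; v; t]]set3_swap !(global_moebius_eq rep glob) // subrr => /esym.
  move/matrixP/(_ 1 0); rewrite !mxE /= mulr1 => /eqP.
  rewrite mulf_eq0 invr_eq0 (negPf (omega_neq0 packP f g)) orbF.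
  by rewrite fmorph_eq0 => /eqP.
(* Once [lambda] vanishes, the matrices themselves agree across interior edges, so they are constant
   on the disk. *)
have same := glue_disk (G := G) (f := val \o Phi).
case: (pickP (fun p : V * V * V => G p.1.1 p.1.2 p.2)) => [[[u0 v0] s0] /= f0|nof].
  exists (Phi [set u0; v0; s0]) => u v uv.
  have tuv := edge_tangent packP uv.
  have Phi0 a b c : G a b c -> Phi [set a; b; c] = Phi [set u0; v0; s0].
    move=> f; apply/val_inj; apply: same f f0 => x y xy /=.
    by apply: subr0_eq; rewrite jump // lambda0 // rmorph0 mul0r scale0r.
  have [s [f|f]] := edge_face uv; rewrite -(Phi0 _ _ _ f); have [h _ _] := rep _ _ _ f.
    exact: h.
  (* The face lies to the right of the edge, so the value at [(v, u)] is carried over by symmetry of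
     the tangency point and of its change. *)
  have S0 := radii_neq0 tuv; have S0' := radii_neq0 (tangent_sym tuv).
  rewrite -(tangency_sym tuv) -h !dtangency_pointE //.
  by rewrite (tangency_change_sym D tuv).
(* Without faces there are no edges, and any matrix serves. *)
exists (Phi set0) => u v /edge_face[s [f|f]].
  by have := nof (u, v, s); rewrite /= f.
by have := nof (v, u, s); rewrite /= f.
Qed.

End Main.

Theorem proposition4p6 (R : realType) (V : finType) (G : triangulated_disk V)
    (P : circles R V) (packP : circle_packing G P) (Phi : {set V} -> sl2 R) :
  ((exists D : variation R V,
      infinitesimal_deformation G P D /\ represents G P Phi D)
   <-> (exists lambda : {set V} -> R, jump_condition G P Phi lambda))
  /\ (forall (D : variation R V) (lambda : {set V} -> R),
        infinitesimal_deformation G P D -> represents G P Phi D ->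
        jump_condition G P Phi lambda ->
        [/\ koebe_quadratic_differential G P lambda,
            (forall u v, interior_edge G u v ->
               (lambda [set u; v])%:C
               = dcr_dagger G P D u v / cr_dagger G P u v)
          & (induced_by_global_moebius G P D
             <-> (forall u v, interior_edge G u v ->
                    lambda [set u; v] = 0))]).
Proof.
split; first split=> [[D [def rep]]|[lambda jump]].
- by exists (jump_lambda G P Phi); apply: represents_jump_condition rep.
- exists (glued_variation G P Phi); split.
    exact: glued_deformation jump.
  exact: glued_represents jump.
- move=> D lambda def rep jump; split.
  + exact: jump_koebe jump.
  + exact: jump_cr_dagger rep jump.
  + exact: global_moebius_iff rep jump.
Qed.
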